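(* Let $r\ge 2$ be an integer. Every graph $G$ with $m$ edges contains a subgraph with at least $\frac14 m^{r/(r+1)}$ edges which contains no copy of $K_{r,r}$.
   Context: $K_{r,r}$ is the complete bipartite graph with both parts of order $r$. *)

(* Defs.v *)
From mathcomp Require Import all_boot.

Set Implicit Arguments.
Unset Strict Implicit.
Unset Printing Implicit Defensive.

(* Finite simple graphs with vertices drawn from T; the vertex set is explicit
   so that subgraphs need not be spanning. *)
Record sgraph (T : finType) := SGraph {
  vertices : {set T};
  edges : {set {set T}};
  edgesP : forall e : {set T},
    e \in edges -> #|e| = 2 /\ e \subset vertices
}.

Definition is_subgraph (T : finType) (H G : sgraph T) : Prop :=
  vertices H \subset vertices G /\ edges H \subset edges G.

(* A copy need not be induced. *)
Definition contains_copy (U T : finType) (F : sgraph U) (G : sgraph T) : Prop :=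
  exists f : U -> T,
    [/\ {in vertices F &, injective f},
        forall u : U, u \in vertices F -> f u \in vertices G
      & forall e : {set U}, e \in edges F -> f @: e \in edges G].

Definition Krr_edges (r : nat) : {set {set 'I_r + 'I_r}} :=
  [set [set inl i; inr j] | i in [set: 'I_r], j in [set: 'I_r]].

Lemma Krr_edgesP (r : nat) (e : {set 'I_r + 'I_r}) :
  e \in Krr_edges r -> #|e| = 2 /\ e \subset [set: 'I_r + 'I_r].
Proof. by case/imset2P => i j _ _ ->; rewrite cards2 subsetT. Qed.

Definition Krr (r : nat) : sgraph ('I_r + 'I_r)%type :=
  SGraph (@Krr_edgesP r).

(* Main.v *)
Require Import Defs.
From HB Require Import structures.
From mathcomp Require Import all_boot all_order all_algebra.
From mathcomp Require Import all_classical all_reals all_analysis.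
From mathcomp Require Import fintype finset ring lra zify.
Import Order.TTheory GRing.Theory Num.Theory.
Local Open Scope ring_scope.

(** Deletion method. Keep every edge of [G] independently with probability [p]
    and delete one edge from each surviving copy of [K_{r,r}]. A copy is
    determined by the images of its [r] matching edges, so there are at most
    [(2m)^r] labelled copies, and some outcome keeps at least
    [p m - p^(r^2) (2m)^r] edges. For [p = m^(-1/(r+1)) / 2] the first term is
    [m^(r/(r+1)) / 2] and the second one is at most half of it, since
    [r + 2 <= r^2]. *)

Section BernoulliSubset.
Variables (R : realFieldType) (I : finType) (p : R).

Definition bernoulli_weight (S : {set I}) : R :=
  \prod_i (if i \in S then p else 1 - p).

Lemma bernoulli_weight_ge0 (S : {set I}) :
  0 <= p <= 1 -> 0 <= bernoulli_weight S.
Proof.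
by move=> /andP[p0 p1]; apply: prodr_ge0 => i _; case: ifP => // _; rewrite subr_ge0.
Qed.

(** Distributivity: expanding the product of [p + (if i \in A then 0 else 1 - p)] over [i] gives one
    term per [S], the set of indices where [p] is chosen. The zeros kill every [S] that misses a
    point of [A]. *)
Lemma sum_bernoulli_weight_subset (A : {set I}) :
  \sum_(S : {set I} | A \subset S) bernoulli_weight S = p ^+ #|A|.
Proof.
have -> : p ^+ #|A| = \prod_i (p + (if i \in A then 0 else 1 - p)).
  rewrite -prodr_const [RHS](bigID (mem A)) /= [X in _ * X]big1 ?mulr1.
    by apply: eq_bigr => i ->; rewrite addr0.
  by move=> i /negbTE ->; rewrite addrC subrK.
rewrite bigA_distr big_mkcond; apply: eq_bigr => S _.
case: ifPn => [/subsetP sAS|/subsetPn[i iA iNS]].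
  apply: eq_bigr => i _; case: ifPn => // iNS.
  by rewrite ifN //; apply: contra iNS; apply: sAS.
by rewrite (bigD1 i) //= (negbTE iNS) iA mul0r.
Qed.

Lemma sum_bernoulli_weight : \sum_(S : {set I}) bernoulli_weight S = 1.
Proof.
rewrite -[RHS](expr0 p) -(cards0 I) -sum_bernoulli_weight_subset.
by apply: eq_bigl => S; rewrite sub0set.
Qed.

(** Linearity of expectation, for the number of sets [A j] that survive in a random [S]. *)
Lemma sum_bernoulli_weight_family (J : finType) (A : J -> {set I}) (P : pred J) :
  \sum_(S : {set I}) bernoulli_weight S * #|[set j | P j & A j \subset S]|%:R
  = \sum_(j | P j) p ^+ #|A j|.
Proof.
under [RHS]eq_bigr => j _ do rewrite -sum_bernoulli_weight_subset big_mkcond.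
rewrite exchange_big; apply: eq_bigr => S _.
rewrite -sum1dep_card natr_sum mulr_sumr big_mkcondr.
by apply: eq_bigr => j _; case: ifP; rewrite ?mulr1.
Qed.

Lemma exists_subset_few_contained (J : finType) (A : J -> {set I}) (P : pred J)
    (E : {set I}) (k : nat) :
  0 <= p <= 1 -> (forall j, P j -> #|A j| = k) ->
  exists S : {set I},
    p * #|E|%:R - p ^+ k * #|P|%:R
    <= #|E :&: S|%:R - #|[set j | P j & A j \subset S]|%:R.
Proof.
move=> p01 cardA.
pose val (S : {set I}) : R :=
  #|E :&: S|%:R - #|[set j | P j & A j \subset S]|%:R.
have mean_val : \sum_(S : {set I}) bernoulli_weight S * val S =
    p * #|E|%:R - p ^+ k * #|P|%:R.
  under eq_bigr => S _ do rewrite mulrBr.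
  rewrite sumrB sum_bernoulli_weight_family; congr (_ - _).
    (* [E :&: S] is counted as the family of singletons of [E] contained in [S]. *)
    transitivity (\sum_(i in E) p ^+ #|[set i]|).
      rewrite -(sum_bernoulli_weight_family _ (fun i => [set i]) (mem E)).
      apply: eq_bigr => S _; congr (_ * #|pred_of_set _|%:R).
      by apply/setP => i; rewrite !inE sub1set.
    by under eq_bigr => i _ do rewrite cards1 expr1; rewrite sumr_const mulr_natr.
  under eq_bigr => j Pj do rewrite cardA //.
  by rewrite sumr_const mulr_natr.
(* A maximiser of [val] is at least the mean, since the weights are nonnegative and sum to 1. *)
case: (@Order.TotalTheory.arg_maxP _ _ _ set0 xpredT val isT) => S0 _ S0max.
exists S0; rewrite -mean_val -/(val S0) -[leRHS]mul1r -sum_bernoulli_weight mulr_suml.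
by apply: ler_sum => S _; apply: ler_wpM2l; [exact: bernoulli_weight_ge0 | exact: S0max].
Qed.

End BernoulliSubset.

Section Copies.
Variables (T : finType) (r : nat).

Definition copy_edges (f : {ffun 'I_r + 'I_r -> T}) : {set {set T}} :=
  [set [set f (inl ij.1); f (inr ij.2)] | ij : 'I_r * 'I_r].

Definition is_copy (E : {set {set T}}) (f : {ffun 'I_r + 'I_r -> T}) : bool :=
  injectiveb f && (copy_edges f \subset E).

(** An edge determines its index pair: by injectivity, its endpoint [f (inl i)] cannot be the [inr]
    endpoint of another edge. *)
Lemma card_copy_edges (f : {ffun 'I_r + 'I_r -> T}) :
  injective f -> #|copy_edges f| = (r ^ 2)%N.
Proof.
move=> injf; rewrite card_imset ?card_prod ?card_ord ?mulnn //.
move=> [i j] [i' j'] /= /setP eq_e.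
move: (eq_e (f (inl i))) (eq_e (f (inr j))).
by rewrite !inE !(inj_eq injf) !eqxx /= => /esym/orP[] // /eqP[->] /esym/eqP[->].
Qed.

Lemma contains_copy_Krr (H : sgraph T) :
  contains_copy (Krr r) H -> exists f, is_copy (edges H) f.
Proof.
case=> f [injf _ fE]; exists [ffun u => f u]; apply/andP; split.
  by apply/injectiveP => u v; rewrite !ffunE; apply: injf; rewrite inE.
apply/subsetP => _ /imsetP[[i j] _ ->]; rewrite !ffunE /=.
have := fE [set inl i; inr j]; rewrite imsetU1 imset_set1; apply.
exact: imset2_f.
Qed.

(** Forgetting the order maps these pairs to [E], and the fibre over [[set a; b]] lies in
    [[set (a, b); (b, a)]]. *)
Lemma card_ordered_edges (E : {set {set T}}) :
  (forall e, e \in E -> #|e| = 2) ->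
  (#|[set x : T * T | [set x.1; x.2] \in E]| <= 2 * #|E|)%N.
Proof.
move=> E2; rewrite -sum1dep_card.
rewrite (partition_big (fun x : T * T => [set x.1; x.2]) (mem E)) //=.
rewrite mulnC -sum_nat_const; apply: leq_sum => e eE.
have /eqP/cards2P[a [b [_ ->]]] := E2 _ eE.
rewrite sum1dep_card; apply: (@leq_trans #|[set (a, b); (b, a)]|); last first.
  by rewrite cards2; case: eqP.
apply/subset_leq_card/subsetP => -[x y]; rewrite !inE /= => /andP[_ /eqP/setP xyab].
move: (xyab x) (xyab y) (xyab a) (xyab b); rewrite !inE !eqxx !orbT /= !xpair_eqE.
rewrite ![a == _]eq_sym ![b == _]eq_sym.
do ![case: eqVneq => ? //=]; subst; rewrite ?eqxx //.
Qed.

Lemma card_copies (E : {set {set T}}) :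
  (forall e, e \in E -> #|e| = 2) -> (#|is_copy E| <= (2 * #|E|) ^ r)%N.
Proof.
move=> E2; set D := [set x : T * T | [set x.1; x.2] \in E].
pose matching (f : {ffun 'I_r + 'I_r -> T}) : {ffun 'I_r -> T * T} :=
  [ffun i => (f (inl i), f (inr i))].
have matching_inj : injective matching.
  move=> f g /ffunP fg; apply/ffunP => -[] i; move: (fg i);
  by rewrite !ffunE => -[].
apply: (@leq_trans (#|D| ^ r)%N); last first.
  (* For [r = 0] both powers are 1; [leq_exp2r] needs a positive exponent. *)
  by have [->//|r_gt0] := posnP r; rewrite leq_exp2r ?card_ordered_edges.
rewrite -[X in (_ <= _ ^ X)%N]card_ord -card_ffun_on.
rewrite -(card_image matching_inj); apply/subset_leq_card/subsetP.
move=> _ /imageP[f /andP[_ /subsetP fE] ->]; apply/ffun_onP => i.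
by rewrite ffunE inE; apply: fE; apply/imsetP; exists (i, i).
Qed.

End Copies.

Lemma deletion_bound (R : realFieldType) (r : nat) (T : finType) (G : sgraph T) (p : R) :
  (0 < r)%N -> 0 <= p <= 1 ->
  exists H : sgraph T,
    [/\ is_subgraph H G,
        p * #|edges G|%:R - p ^+ (r ^ 2) * (2 * #|edges G|%:R) ^+ r <= #|edges H|%:R
      & ~ contains_copy (Krr r) H].
Proof.
case: r => // r _ p01; set E := edges G.
have cardA f : is_copy T r.+1 E f -> #|copy_edges T r.+1 f| = (r.+1 ^ 2)%N.
  by case/andP => /injectiveP injf _; apply: card_copy_edges.
have [S leS] := exists_subset_few_contained _ _ _ _ (copy_edges T r.+1)
                  (is_copy T r.+1 E) E _ p01 cardA.
set C := [set f | _ & _] in leS.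
(* The edge deleted from each copy; [ord0] exists because [r] is positive. *)
pose marked (f : {ffun 'I_r.+1 + 'I_r.+1 -> T}) := [set f (inl ord0); f (inr ord0)].
pose EH := (E :&: S) :\: (marked @: C).
have EHE : EH \subset E by rewrite subDset subsetU // subsetIl orbT.
have EHP e : e \in EH -> #|e| = 2 /\ e \subset vertices G.
  by move=> /(subsetP EHE); apply: edgesP.
exists (SGraph EHP); split => //=.
- apply: (@le_trans _ _ (#|E :&: S|%:R - #|C|%:R)); last first.
    (* Copies may share a marked edge, so at most [#|C|] edges are deleted. *)
    rewrite lerBlDr -natrD ler_nat cardsD addnC -leq_subLR.
    rewrite leq_sub2l // (leq_trans (subset_leq_card (subsetIr _ _))) //.
    exact: leq_imset_card.
  apply: le_trans leS; rewrite lerB // ler_wpM2l ?exprn_ge0 //; first by case/andP: p01.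
  by rewrite -natrM -natrX ler_nat card_copies // => e /edgesP[].
(* A surviving copy would lie in [E :&: S], hence belong to [C], so its marked edge would have been
   deleted. *)
- case/contains_copy_Krr => f /andP[/= injf /subsetP fEH].
  have mf : marked f \in copy_edges T r.+1 f by apply/imsetP; exists (ord0, ord0).
  have /setDP[_ /negP[]] := fEH _ mf.
  apply: imset_f; rewrite inE /is_copy injf /=; apply/andP; split;
    by apply/subsetP => e /fEH /setDP[/setIP[]].
Qed.

Theorem theorem3p1 (R : realType) (r : nat) (hr : (2 <= r)%N)
    (T : finType) (G : sgraph T) (m : nat) (hm : #|edges G| = m) :
  exists H : sgraph T,
    [/\ is_subgraph H G,
        4^-1 * (m%:R : R) `^ (r%:R / (r%:R + 1)) <= #|edges H|%:R
      & ~ contains_copy (Krr r) H].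
Proof.
have r_gt0 : (0 < r)%N by exact: ltnW.
have r1_neq0 : r%:R + 1 != 0 :> R by rewrite natr1 pnatr_eq0.
have [m0|m_gt0] := posnP m.
  (* With no edges the required bound is 0, as the exponent is nonzero; [p = 0] is just an
     admissible choice. *)
  have [|H [HG _ HK]] := deletion_bound R r T G 0 r_gt0; first by rewrite lexx ler01.
  exists H; split => //; rewrite m0 powR0 ?mulr0 //.
  by rewrite mulf_neq0 ?invr_eq0 // pnatr_eq0 -lt0n.
(* In terms of [x] all real powers become natural ones: [m] is [x ^+ r.+1], the target is
   [x ^+ r / 4], and [p] is [(2 * x)^-1]. *)
pose x : R := m%:R `^ (r%:R + 1)^-1.
have x_gt0 : 0 < x by apply: powR_gt0; rewrite ltr0n.
have x_ge1 : 1 <= x.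
  rewrite -(powRr0 m%:R) ler_powR ?ler1n // invr_ge0; exact: addr_ge0.
have xr : m%:R `^ (r%:R / (r%:R + 1)) = x ^+ r by rewrite mulrC powRrM powR_mulrn ?ltW.
have xr1 : x ^+ r.+1 = m%:R.
  by rewrite -powR_mulrn ?ltW // -powRrM -natr1 mulVf // powRr1.
have [|H [HG leH HK]] := deletion_bound R r T G (2 * x)^-1 r_gt0.
  rewrite invr_ge0 invf_le1; lra.
exists H; split => //; apply: le_trans leH; rewrite hm xr -xr1.
have -> : (2 * x)^-1 * x ^+ r.+1 = x ^+ r / 2 
  by rewrite exprS invfM -mulrA mulKf ?gt_eqF // mulrC.
(* The exponent of [x] is [r * (r + 1) - r ^ 2 = r], and that of 2 is [r - r ^ 2]. *)
have -> : (2 * x)^-1 ^+ (r ^ 2) * (2 * x ^+ r.+1) ^+ r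
    = x ^+ r * (2 ^+ (r ^ 2 - r))^-1.
  have -> : (r ^ 2 = r * r)%N by rewrite mulnn.
  have e2 : (2 : R) ^+ (r * r) = 2 ^+ (r * r - r) * 2 ^+ r.
    by rewrite -exprD subnK // leq_pmulr.
  have c_neq0 : x ^+ (r * r) != 0 by rewrite expf_neq0 ?gt_eqF.
  have b_neq0 : (2 : R) ^+ r != 0 by rewrite expf_neq0 ?pnatr_eq0.
  have a_neq0 : (2 : R) ^+ (r * r - r) != 0 by rewrite expf_neq0 ?pnatr_eq0.
  rewrite exprVn !exprMn -exprM mulSn exprD e2.
  move: (x ^+ (r * r)) (_ ^+ (r * r - r)) (2 ^+ r) (x ^+ r) c_neq0 a_neq0 b_neq0.
  by move=> c a b d c_neq0 a_neq0 b_neq0; field; rewrite c_neq0 a_neq0.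
(* As [r >= 2] gives [r ^ 2 - r >= 2], the loss is at most [x ^+ r / 4], which leaves [x ^+ r / 4]
   out of [x ^+ r / 2]. *)
have : ((2 : R) ^+ (r ^ 2 - r))^-1 <= 2 ^- 2.
  rewrite lef_pV2 ?posrE ?exprn_gt0 // ler_weXn2l ?ler1n //; nia.
have := exprn_gt0 r x_gt0; nra.
Qed.
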